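(* Let $L>2$ be an integer, let $d,D\ge2$ be integers, and let $\mathcal X\subset\mathbb R^d$ have nonempty interior, with fixed base point $\mathrm e\in\mathcal X$. Let $R_L$ be the extended representation cost of depth-$L$ ReLU networks with weight decay on $\mathrm{Lip}(\mathcal X;\mathbb R^D)$, let $\mathcal F_L=\{f: R_L(f)<+\infty\}$, and let $\|f\|_{\mathcal F_L}=\max\{R_L(f)^{L/2},\|f(\mathrm e)\|_2\}$. Then the two unit balls $$\{f\in\mathcal F_L: R_L(f)\le1\}\quad\text{and}\quad\{f\in\mathcal F_L: R_L(f)^{L/2}\le1\}$$ coincide and are nonconvex. Consequently, the unit ball $\{f\in\mathcal F_L:\|f\|_{\mathcal F_L}\le1\}$ is nonconvex. In particular, $R_L^{L/2}$ is not a seminorm on $\mathcal F_L$ and $\|\cdot\|_{\mathcal F_L}$ is not a norm on $\mathcal F_L$.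
   Context: **Lipschitz space and weak\* topology.** $\mathcal X\subset\mathbb R^d$ carries the Euclidean metric. $\mathrm{Lip}(\mathcal X;\mathbb R^D)$ is the space of Lipschitz maps $f:\mathcal X\to\mathbb R^D$, with norm $\max\{|f|_{\mathrm{Lip}},\|f(\mathrm e)\|_2\}$, $|f|_{\mathrm{Lip}}=\sup_{x\ne y}\|f(x)-f(y)\|_2/\|x-y\|_2$. The Arens–Eells space $\mathrm{AE}(\mathcal X)$ is the completion of the span of $\{\delta_x-\delta_y:x,y\in\mathcal X\}$ under $\|m\|=\inf\{\sum_i|a_i|\,\|x_i-y_i\|_2: m=\sum_i a_i(\delta_{x_i}-\delta_{y_i})\}$; it is the predual of the scalar Lipschitz functions vanishing at $\mathrm e$, via $\langle\sum_i a_i(\delta_{x_i}-\delta_{y_i}),g\rangle=\sum_i a_i(g(x_i)-g(y_i))$. $\mathrm{Lip}(\mathcal X;\mathbb R^D)$ is isometrically the dual of $(\mathrm{AE}(\mathcal X)\widehat\otimes_\pi\mathbb R^D)\oplus_1\mathbb R^D$, and $w^*$ is the corresponding weak\* topology: the coarsest topology making $f\mapsto\langle m,f_j-f_j(\mathrm e)\rangle$ and $f\mapsto f_j(\mathrm e)$ continuous for all components $j$ and all $m\in \mathrm{AE}(\mathcal X)$. **Lower semicontinuous regularization.** A function $K$ on a topological space with values in $[-\infty,+\infty]$ is l.s.c. if all sublevel sets $\{K\le\alpha\}$, $\alpha\in\mathbb R$, are closed. Its l.s.c. regularization is the largest l.s.c. function bounded above by $K$. **Deep ReLU networks.** $\Theta_L$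 is the set of tuples $\theta=((W_1,b_1),\dots,(W_L,b_L))$ with $W_\ell\in\mathbb R^{K_{\ell+1}\times K_\ell}$, $b_\ell\in\mathbb R^{K_{\ell+1}}$, $K_1=d$, $K_{L+1}=D$, and arbitrary finite hidden widths $K_2,\dots,K_L\in\mathbb N$. Set $f_\theta=a_L\circ\sigma\circ a_{L-1}\circ\cdots\circ\sigma\circ a_1$ restricted to $\mathcal X$, $a_\ell(z)=W_\ell z+b_\ell$, $\sigma=\max\{0,\cdot\}$ entrywise. The parameter cost is $C_L(\theta)=\frac1L\sum_{\ell=1}^L\|W_\ell\|_F^2$. Define $R_{\Theta_L}(f)=\inf\{C_L(\theta):\theta\in\Theta_L,\ f_\theta=f\}$ for $f\in\mathrm{Lip}(\mathcal X;\mathbb R^D)$ ($\inf\varnothing=+\infty$). $R_L$ is the $w^*$-l.s.c. regularization of $R_{\Theta_L}$ on $\mathrm{Lip}(\mathcal X;\mathbb R^D)$. *)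

(* Defs.v *)
From HB Require Import structures.
From mathcomp Require Import all_boot all_order all_algebra.
From mathcomp Require Import all_classical all_reals all_analysis.
From mathcomp Require Import ring.

Set Implicit Arguments.
Unset Strict Implicit.
Unset Printing Implicit Defensive.

Import Order.TTheory GRing.Theory Num.Theory.
Import numFieldNormedType.Exports.

Local Open Scope classical_set_scope.
Local Open Scope ring_scope.

(* MathComp-Analysis norms matrices by the maximum of the entries, hence the
   explicit Euclidean and Frobenius norms. *)
Definition enorm (R : realType) (n : nat) (x : 'cV[R]_n) : R :=
  Num.sqrt (\sum_i x i 0 ^+ 2).

Definition frobenius (R : realType) (m n : nat) (W : 'M[R]_(m, n)) : R :=
  Num.sqrt (\sum_i \sum_j W i j ^+ 2).

Section Lipschitz.
Variables (R : realType) (d D : nat) (X : set 'cV[R]_d).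

Definition lipschitz_map : {pred X -> 'cV[R]_D} :=
  mem [set f : X -> 'cV[R]_D | exists k : R, forall x y : X,
    enorm (f x - f y) <= k * enorm (val x - val y)].

Record Lip := MkLip {
  lip_fun :> X -> 'cV[R]_D ;
  lip_funP : lip_fun \in lipschitz_map }.

HB.instance Definition _ := [isSub for lip_fun].
HB.instance Definition _ := [Choice of Lip by <:].

Lemma enormZ n (a : R) (x : 'cV[R]_n) : enorm (a *: x) = `|a| * enorm x.
Proof.
rewrite /enorm -sqrtr_sqr -sqrtrM ?sqr_ge0// mulr_sumr; congr Num.sqrt.
by apply: eq_bigr => i _; rewrite mxE exprMn.
Qed.

Lemma enorm_ge0 n (x : 'cV[R]_n) : 0 <= enorm x.
Proof. exact: sqrtr_ge0. Qed.

Lemma enormD_le n (x y : 'cV[R]_n) :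
  enorm (x + y) <= Num.sqrt 2 * (enorm x + enorm y).
Proof.
have sx : 0 <= \sum_i x i 0 ^+ 2 by apply: sumr_ge0 => i _; exact: sqr_ge0.
have sy : 0 <= \sum_i y i 0 ^+ 2 by apply: sumr_ge0 => i _; exact: sqr_ge0.
rewrite -[leRHS]ger0_norm; last first.
  by rewrite mulr_ge0 ?sqrtr_ge0// addr_ge0 ?enorm_ge0.
rewrite -sqrtr_sqr ler_wsqrtr// exprMn sqr_sqrtr//.
apply: (@le_trans _ _ (2 * (\sum_i x i 0 ^+ 2 + \sum_i y i 0 ^+ 2))).
  rewrite -big_split mulr_sumr; apply: ler_sum => i _ /=.
  rewrite mxE -subr_ge0.
  by rewrite (_ : _ - _ = (x i 0 - y i 0) ^+ 2) ?sqr_ge0//; ring.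
rewrite ler_pM2l// sqrrD !sqr_sqrtr// -addrAC lerDl.
by rewrite mulrn_wge0// mulr_ge0 ?enorm_ge0.
Qed.

Lemma lipschitz_map_submod_closed : submod_closed lipschitz_map.
Proof.
split.
  rewrite inE; exists 0 => x y; rewrite subrr mul0r.
  by rewrite -(scale0r (0 : 'cV[R]_D)) enormZ normr0 mul0r.
move=> a f g; rewrite !inE => -[k kf] [l lg].
exists (Num.sqrt 2 * (`|a| * k + l)) => x y.
rewrite (_ : _ - _ = a *: (f x - f y) + (g x - g y)); last first.
  by rewrite scalerBr opprD addrACA.
apply: (le_trans (enormD_le _ _)); rewrite enormZ -mulrA ler_wpM2l ?sqrtr_ge0//.
by rewrite mulrDl lerD// -mulrA ler_wpM2l.
Qed.

HB.instance Definition _ := GRing.isSubmodClosed.Build R (X -> 'cV[R]_D)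
  lipschitz_map lipschitz_map_submod_closed.
HB.instance Definition _ := [SubChoice_isSubLmodule of Lip by <:].

End Lipschitz.

Section ArensEells.
Variables (R : realType) (d : nat) (X : set 'cV[R]_d).

(* The triples (a, (x, y)) of s stand for the formal sum of the
   a (delta_x - delta_y); molecule s is its function of coefficients. *)
Definition molecule (s : seq (R * (X * X))) : X -> R := fun z =>
  \sum_(t <- s) t.1 * ((z == t.2.1)%:R - (z == t.2.2)%:R).

Definition mol_cost (s : seq (R * (X * X))) : R :=
  \sum_(t <- s) `|t.1| * enorm (val t.2.1 - val t.2.2).

Definition ae_norm (m : X -> R) : R :=
  inf [set mol_cost s | s in [set s | molecule s = m]].

(* A point of the completion AE(X) is given by a Cauchy sequence of molecules;
   sequences at distance 0 represent the same point and have the same pairing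
   with every Lipschitz function. *)
Record AE := MkAE {
  ae_seq :> nat -> seq (R * (X * X)) ;
  ae_cauchy : forall eps : R, 0 < eps -> exists N : nat,
    forall i j : nat, (N <= i)%N -> (N <= j)%N ->
      ae_norm (molecule (ae_seq i) - molecule (ae_seq j)) < eps }.

Definition mol_pair (s : seq (R * (X * X))) (g : X -> R) : R :=
  \sum_(t <- s) t.1 * (g t.2.1 - g t.2.2).

Definition ae_pair (m : AE) (g : X -> R) : R :=
  limn (fun n => mol_pair (m n) g).

Lemma mol_pair_coef (s : seq (R * (X * X))) (U : seq X) (g : X -> R) :
  uniq U -> (forall t, t \in s -> (t.2.1 \in U) && (t.2.2 \in U)) ->
  mol_pair s g = \sum_(z <- U) molecule s z * g z.
Proof.
move=> uU sU; rewrite /mol_pair /molecule.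
under [RHS]eq_bigr do rewrite mulr_suml.
rewrite exchange_big /=; apply: eq_big_seq => t /sU /andP[xU yU].
under eq_bigr do rewrite -mulrA.
rewrite -mulr_sumr; congr (_ * _).
under eq_bigr do rewrite mulrBl.
have pick w : w \in U -> \sum_(z <- U) (z == w)%:R * g z = g w.
  move=> wU; rewrite (bigD1_seq w)//= eqxx mul1r big1 ?addr0// => z /negPf ->.
  by rewrite mul0r.
by rewrite sumrB !pick.
Qed.

Lemma mol_pair_wd (s s' : seq (R * (X * X))) (g : X -> R) :
  molecule s = molecule s' -> mol_pair s g = mol_pair s' g.
Proof.
move=> ss'.
pose U := undup ([seq t.2.1 | t <- s ++ s'] ++ [seq t.2.2 | t <- s ++ s']).
have inU t : t \in s ++ s' -> (t.2.1 \in U) && (t.2.2 \in U).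
  move=> ts; rewrite !mem_undup !mem_cat.
  by rewrite (map_f (fun t => t.2.1) ts) (map_f (fun t => t.2.2) ts) orbT.
rewrite !(@mol_pair_coef _ U) ?undup_uniq// ?ss'// => t ts; apply: inU.
  by rewrite mem_cat ts orbT.
by rewrite mem_cat ts.
Qed.

Lemma mol_pair_le (s : seq (R * (X * X))) (g : X -> R) (k : R) : 0 < k ->
  (forall x y : X, `|g x - g y| <= k * enorm (val x - val y)) ->
  `|mol_pair s g| <= k * ae_norm (molecule s).
Proof.
move=> k0 gk; rewrite mulrC -ler_pdivrMr//; apply: lb_le_inf.
  by exists (mol_cost s), s.
move=> _ [s' s's <-]; rewrite ler_pdivrMr// -(mol_pair_wd g s's).
apply: (le_trans (ler_norm_sum _ _ _)); rewrite mulr_suml.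
by apply: ler_sum => t _; rewrite normrM -mulrA ler_wpM2l// mulrC.
Qed.

Lemma mol_pairB (s s' : seq (R * (X * X))) : exists s'',
  molecule s'' = molecule s - molecule s' /\
  forall g, mol_pair s'' g = mol_pair s g - mol_pair s' g.
Proof.
exists (s ++ [seq (- t.1, t.2) | t <- s']); split.
  apply/funext => z; rewrite /molecule big_cat big_map /= -[RHS]/(_ - _).
  by rewrite -sumrN; congr (_ + _); apply: eq_bigr => t _; rewrite mulNr.
move=> g; rewrite /mol_pair big_cat big_map /= -sumrN; congr (_ + _).
by apply: eq_bigr => t _; rewrite mulNr.
Qed.

Lemma ae_pair_cvg (m : AE) (g : X -> R) (k : R) :
  (forall x y : X, `|g x - g y| <= k * enorm (val x - val y)) ->
  cvgn (fun n => mol_pair (m n) g).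
Proof.
move=> gk; pose l := `|k| + 1.
have l0 : 0 < l by rewrite ltr_wpDl.
have gl x y : `|g x - g y| <= l * enorm (val x - val y).
  apply: (le_trans (gk x y)); rewrite ler_wpM2r ?enorm_ge0//.
  by rewrite (le_trans (ler_norm k))// lerDl.
apply/cauchy_cvgP/cauchy_ballP => eps eps0; near_simpl.
have [N mN] := ae_cauchy m (divr_gt0 eps0 l0).
near=> i j; rewrite /ball /=.
have [s [sE /(_ g) <-]] := mol_pairB (m i) (m j).
apply: (le_lt_trans (mol_pair_le _ l0 gl)).
rewrite sE mulrC -ltr_pdivlMr//; apply: mN.
  by near: i; exact: nbhs_infty_ge.
by near: j; exact: nbhs_infty_ge.
Unshelve. all: by end_near. Qed.

End ArensEells.

Section WeakStar.
Variables (R : realType) (d D : nat) (X : set 'cV[R]_d) (e : X).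

(* inl (j, m) is the functional f |-> <m, f_j - f_j(e)>, inr j is
   f |-> f_j(e). *)
Definition wstar_functional (i : ('I_D * AE X) + 'I_D) (f : Lip D X) : R :=
  match i with
  | inl (j, m) => ae_pair m (fun x => f x j 0 - f e j 0)
  | inr j => f e j 0
  end.

Definition wstar : Type := sup_topology (fun i =>
  Topological.on (initial_topology (wstar_functional i))).
HB.instance Definition _ := Topological.on wstar.

End WeakStar.

(* The largest l.s.c. minorant of K (lsc_reg_largest). *)
Definition lsc_reg (R : realType) (T : topologicalType) (K : T -> \bar R)
    : T -> \bar R := fun x =>
  ereal_sup [set H x | H in [set H : T -> \bar R |
    lower_semicontinuous H /\ forall y, (H y <= K y)%E]].

Lemma lower_semicontinuous_closed (R : realType) (T : topologicalType)
    (K : T -> \bar R) :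
  lower_semicontinuous K <-> forall a : R, closed [set x | (K x <= a%:E)%E].
Proof.
have setE a : [set x | (K x <= a%:E)%E] = ~` [set x | (a%:E < K x)%E].
  by apply/seteqP; split=> x /=; rewrite leNgt => /negP.
rewrite lower_semicontinuousP; split=> H a.
  by rewrite setE; exact: open_closedC.
by rewrite -[X in open X]setCK -setE; exact: closed_openC.
Qed.

Lemma lsc_reg_largest (R : realType) (T : topologicalType) (K : T -> \bar R) :
  [/\ lower_semicontinuous (lsc_reg K),
      forall x, (lsc_reg K x <= K x)%E &
      forall H : T -> \bar R, lower_semicontinuous H ->
        (forall x, (H x <= K x)%E) -> forall x, (H x <= lsc_reg K x)%E].
Proof.
split.
- move=> x a /ereal_sup_gt[_ [H [Hlsc HK] <-] aH].
  have [V xV Va] := Hlsc x a aH; exists V => // y /Va ay.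
  by apply: (lt_le_trans ay); apply: ereal_sup_ubound; exists H.
- by move=> x; apply: ge_ereal_sup => _ [H [_ HK] <-].
- by move=> H Hlsc HK x; apply: ereal_sup_ubound; exists H.
Qed.

(* relu_net R L p q is the set of parameters ((W_1, b_1), .., (W_L, b_L)) with
   L layers, input dimension p, output dimension q and arbitrary hidden
   widths. *)
Inductive relu_net (R : realType) : nat -> nat -> nat -> Type :=
| OutputLayer p q (W : 'M[R]_(q, p)) (b : 'cV[R]_q) : relu_net R 1 p q
| HiddenLayer L p k q (W : 'M[R]_(k, p)) (b : 'cV[R]_k)
    (theta : relu_net R L k q) : relu_net R L.+1 p q.

Definition relu (R : realType) (n : nat) (z : 'cV[R]_n) : 'cV[R]_n :=
  map_mx (Num.max 0) z.

Fixpoint realize (R : realType) L p q (theta : relu_net R L p q) :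
    'cV[R]_p -> 'cV[R]_q :=
  match theta with
  | OutputLayer _ _ W b => fun z => W *m z + b
  | HiddenLayer _ _ _ _ W b theta' => fun z => realize theta' (relu (W *m z + b))
  end.

Fixpoint weight_sqnorm (R : realType) L p q (theta : relu_net R L p q) : R :=
  match theta with
  | OutputLayer _ _ W _ => frobenius W ^+ 2
  | HiddenLayer _ _ _ _ W _ theta' => frobenius W ^+ 2 + weight_sqnorm theta'
  end.

Definition net_cost (R : realType) L p q (theta : relu_net R L p q) : R :=
  L%:R^-1 * weight_sqnorm theta.

Section Representation.
Variables (R : realType) (d D : nat) (X : set 'cV[R]_d) (e : X) (L : nat).

Definition param_cost (f : Lip D X) : \bar R :=
  ereal_inf [set (net_cost theta)%:E | theta in
    [set theta : relu_net R L d D | forall x : X, realize theta (val x) = f x]].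

Definition rep_cost (f : Lip D X) : \bar R :=
  lsc_reg (param_cost : wstar D e -> \bar R) f.

Definition rep_cost_pow (f : Lip D X) : \bar R :=
  poweR (rep_cost f) (L%:R / 2).

Definition F_space : set (Lip D X) := [set f | (rep_cost f < +oo)%E].

Definition F_norm (f : Lip D X) : \bar R :=
  maxe (rep_cost_pow f) (enorm (f e))%:E.

End Representation.

(* F is not required to be a linear subspace and p is not required to be
   finite on F, so that the negations of these predicates can only express a
   failure of the (semi)norm axioms themselves. *)
Definition seminorm_on (R : realType) (V : lmodType R) (F : set V)
    (p : V -> \bar R) : Prop :=
  (forall (a : R) (f : V), F f -> p (a *: f) = (`|a|%:E * p f)%E) /\
  (forall f g : V, F f -> F g -> (p (f + g)%R <= p f + p g)%E).

Definition norm_on (R : realType) (V : lmodType R) (F : set V)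
    (p : V -> \bar R) : Prop :=
  seminorm_on F p /\ forall f : V, F f -> p f = 0%E -> f = 0.

(* Main.v *)
(* The midpoint f of the two unit-cost single-neuron networks
   e_j0 relu(x_i0 - h0) and e_j1 relu(x_i1 - h1) equals half the identity in
   the coordinates (x_i0, x_i1) near an interior point c, up to a constant.
   Its relaxed cost exceeds 1 because every network whose increments between
   the points c, c + t e_i0, c - t e_i0, c + t e_i1 are close to those of f
   has a larger cost, and this closeness is weak* open.  Summing over the
   coordinates, f forces prod_l ||W_l||_F >= 1, with near equality only if the
   hidden matrix W_2 has almost rank one.  Up to this rank-one projection the
   images of c + t e_i0, c - t e_i0 and c + t e_i1 would then lie at the same
   distance from the image of c on a line, so that two of them would nearly
   coincide, although f separates them.  AM-GM turns the resulting bound on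
   prod_l ||W_l||_F into a bound on the cost. *)
Require Import Defs.
From mathcomp Require Import all_boot all_order all_algebra.
From mathcomp Require Import all_classical all_reals all_analysis.
From mathcomp Require Import ring lra.

Import Order.TTheory GRing.Theory Num.Theory.
Import numFieldNormedType.Exports.

Local Open Scope classical_set_scope.
Local Open Scope ring_scope.

(** * Inner products and Frobenius norm bounds for images of one, two and three vectors *)

Definition dot {R : realType} {n : nat} (u v : 'cV[R]_n) : R :=
  \sum_i u i 0 * v i 0.

Section Dot.
Set Implicit Arguments.
Unset Strict Implicit.
Context {R : realType}.

Lemma dotC n (u v : 'cV[R]_n) : dot u v = dot v u.
Proof. by apply: eq_bigr => i _; rewrite mulrC. Qed.

Lemma dotDl n (u v w : 'cV[R]_n) : dot (u + v) w = dot u w + dot v w.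
Proof. by rewrite -big_split; apply: eq_bigr => i _; rewrite mxE mulrDl. Qed.

Lemma dotZl n (a : R) (u v : 'cV[R]_n) : dot (a *: u) v = a * dot u v.
Proof. by rewrite mulr_sumr; apply: eq_bigr => i _; rewrite mxE mulrA. Qed.

Lemma dotDr n (u v w : 'cV[R]_n) : dot w (u + v) = dot w u + dot w v.
Proof. by rewrite !(dotC w) dotDl. Qed.

Lemma dotZr n (a : R) (u v : 'cV[R]_n) : dot u (a *: v) = a * dot u v.
Proof. by rewrite !(dotC u) dotZl. Qed.

Lemma dotBl n (u v w : 'cV[R]_n) : dot (u - v) w = dot u w - dot v w.
Proof. by rewrite dotDl -scaleN1r dotZl mulN1r. Qed.

Lemma dotBr n (u v w : 'cV[R]_n) : dot w (u - v) = dot w u - dot w v.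
Proof. by rewrite !(dotC w) dotBl. Qed.

Lemma dot_ge0 n (u : 'cV[R]_n) : 0 <= dot u u.
Proof. by apply: sumr_ge0 => i _; rewrite -expr2 sqr_ge0. Qed.

Lemma sqr_enorm n (u : 'cV[R]_n) : enorm u ^+ 2 = dot u u.
Proof.
rewrite /enorm sqr_sqrtr; last by apply: sumr_ge0 => i _; exact: sqr_ge0.
by apply: eq_bigr => i _; rewrite expr2.
Qed.

Lemma dot_cauchy_schwarz n (u v : 'cV[R]_n) :
  dot u v ^+ 2 <= dot u u * dot v v.
Proof.
(* The squared norm of this vector is <v, v> (<u, u> <v, v> - <u, v>^2). *)
have := dot_ge0 (dot v v *: u - dot u v *: v).
rewrite dotBl !dotBr !dotZl !dotZr (dotC v u).
have [v0|] := eqVneq (dot v v) 0.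
  have vi i : v i 0 = 0.
    have /eqP := v0; rewrite psumr_eq0; last by move=> j _; exact: sqr_ge0.
    by move/allP/(_ i (mem_index_enum i)) => /=; rewrite mulf_eq0 orbb => /eqP.
  suff -> : dot u v = 0 by move=> _; rewrite v0 !mulr0 expr0n.
  by apply: big1 => i _; rewrite vi mulr0.
by move=> vn0; have := dot_ge0 v; rewrite le0r (negPf vn0)/=; nra.
Qed.

Lemma mulmx_entry m n (W : 'M[R]_(m, n)) (u : 'cV[R]_n) (i : 'I_m) :
  (W *m u) i 0 = dot (row i W)^T u.
Proof. by rewrite mxE; apply: eq_bigr => j _; rewrite !mxE. Qed.

Lemma dot_mulmx m n (W : 'M[R]_(m, n)) (u : 'cV[R]_n) :
  dot (W *m u) (W *m u) = \sum_i dot (row i W)^T u ^+ 2.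
Proof. by apply: eq_bigr => i _; rewrite mulmx_entry expr2. Qed.

Lemma sqr_frobenius_rows m n (W : 'M[R]_(m, n)) :
  frobenius W ^+ 2 = \sum_i dot (row i W)^T (row i W)^T.
Proof.
rewrite /frobenius sqr_sqrtr.
  by apply: eq_bigr => i _; apply: eq_bigr => j _; rewrite !mxE expr2.
by apply: sumr_ge0 => i _; apply: sumr_ge0 => j _; exact: sqr_ge0.
Qed.

Lemma sqr_frobenius_cols m n (W : 'M[R]_(m, n)) :
  frobenius W ^+ 2 = \sum_j dot (col j W) (col j W).
Proof.
rewrite sqr_frobenius_rows exchange_big.
by apply: eq_bigr => j _; apply: eq_bigr => i _; rewrite !mxE.
Qed.

Lemma dot_mulmx_le m n (W : 'M[R]_(m, n)) (u : 'cV[R]_n) :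
  dot (W *m u) (W *m u) <= frobenius W ^+ 2 * dot u u.
Proof.
rewrite dot_mulmx sqr_frobenius_rows mulr_suml.
by apply: ler_sum => i _; exact: dot_cauchy_schwarz.
Qed.

(* The largest eigenvalue of the Gram matrix of (u, v) is at most
   A + |<u, v>|. *)
Lemma dot_mulmx_pair_le m n (W : 'M[R]_(m, n)) (u v : 'cV[R]_n) (A c : R) :
  dot u u <= A -> dot v v <= A -> `|dot u v| <= c ->
  dot (W *m u) (W *m u) + dot (W *m v) (W *m v) <=
  frobenius W ^+ 2 * (A + c).
Proof.
move=> uA vA uvc; rewrite !dot_mulmx sqr_frobenius_rows -big_split mulr_suml.
apply: ler_sum => i _ /=; set w := (row i W)^T.
set s := dot w u; set r := dot w v.
(* The inner product of [w] with [s *: u + r *: v] is [s ^+ 2 + r ^+ 2], a factor that is divided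
   out at the end. *)
have := dot_cauchy_schwarz w (s *: u + r *: v).
rewrite !dotDr !dotDl !dotZr !dotZl (dotC v u) -/s -/r => cs.
have /ler_normlP[c1 c2] := uvc.
(* [A + c] dominates the quadratic form of the Gram matrix; the slack is at least
   [h1 + h2 + (h3 + h4) / 2]. *)
have Xle : s * (s * dot u u + r * dot u v) + r * (s * dot u v + r * dot v v)
    <= (s ^+ 2 + r ^+ 2) * (A + c).
  have h1 : 0 <= s ^+ 2 * (A - dot u u) by rewrite mulr_ge0 ?sqr_ge0 ?subr_ge0.
  have h2 : 0 <= r ^+ 2 * (A - dot v v) by rewrite mulr_ge0 ?sqr_ge0 ?subr_ge0.
  have h3 : 0 <= (s + r) ^+ 2 * (c - dot u v).
    by rewrite mulr_ge0 ?sqr_ge0//; lra.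
  have h4 : 0 <= (s - r) ^+ 2 * (c + dot u v).
    by rewrite mulr_ge0 ?sqr_ge0//; lra.
  lra.
have Ac0 : 0 <= A + c.
  by have := dot_ge0 u; have := normr_ge0 (dot u v); lra.
have w0 := dot_ge0 w.
have [T0|Tn0] := leP (s ^+ 2 + r ^+ 2) 0.
  by apply: (le_trans T0); rewrite mulr_ge0.
rewrite -(ler_pM2r Tn0) -mulrA [(A + c) * _]mulrC.
apply: le_trans (ler_wpM2l w0 Xle); rewrite -[X in X <= _]expr2.
by rewrite [s ^+ 2]expr2 [r ^+ 2]expr2 !(mulrDr s) !(mulrDr r).
Qed.

(* Some pair has <u_i, u_j> >= - A / 2.  If <u_i, u_j> is small then W is far
   from having rank one on span(u_i, u_j); if it is large then u_i - u_j is
   short. *)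
Lemma three_vectors_bound m n (W : 'M[R]_(m, n)) (u1 u2 u3 : 'cV[R]_n)
    (A B : R) :
  dot u1 u1 <= A -> dot u2 u2 <= A -> dot u3 u3 <= A ->
  B <= dot (W *m u1) (W *m u1) -> B <= dot (W *m u2) (W *m u2) ->
  B <= dot (W *m u3) (W *m u3) ->
  B <= dot (W *m (u1 - u2)) (W *m (u1 - u2)) ->
  B <= dot (W *m (u1 - u3)) (W *m (u1 - u3)) ->
  B <= dot (W *m (u2 - u3)) (W *m (u2 - u3)) ->
  5 * B <= 4 * (frobenius W ^+ 2 * A).
Proof.
(* Let N be the squared Frobenius norm. If <u, v> >= 0, twice 2 B <= N (A + <u, v>) plus B <= 2 N (A
   - <u, v>) gives the claim. Otherwise |<u, v>| <= A / 2, and the first kind of bound alone gives 2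
   B <= 3/2 N A. *)
have pair (u v : 'cV[R]_n) : dot u u <= A -> dot v v <= A ->
    B <= dot (W *m u) (W *m u) -> B <= dot (W *m v) (W *m v) ->
    B <= dot (W *m (u - v)) (W *m (u - v)) ->
    - A <= 2 * dot u v -> 5 * B <= 4 * (frobenius W ^+ 2 * A).
  move=> uA vA uB vB uvB uv.
  have := dot_mulmx_pair_le W uA vA (lexx _).
  have := le_trans uvB (dot_mulmx_le W (u - v)).
  rewrite dotBl !dotBr (dotC v u).
  have := sqr_ge0 (frobenius W); set N := frobenius W ^+ 2 => N0.
  have := dot_ge0 u; set U := dot u u in uA *.
  by case: (ger0P (dot u v)) => ? ?; nra.
move=> u1A u2A u3A u1B u2B u3B u12 u13 u23.
(* This squared norm is at most 3 A plus twice the three inner products, so these cannot all lie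
   below - A / 2. *)
have := dot_ge0 (u1 + u2 + u3); rewrite !dotDl !dotDr.
rewrite (dotC u2 u1) (dotC u3 u1) (dotC u3 u2) => s0.
have [|p12] := leP (- A) (2 * dot u1 u2); first exact: pair.
have [|p13] := leP (- A) (2 * dot u1 u3); first exact: pair.
by apply: (pair u2 u3) => //; lra.
Qed.

End Dot.

(** * Lower bound on the product of the layer norms of a network *)

Fixpoint layer_sqnorms {R : realType} {L p q} (theta : relu_net R L p q) :
    seq R :=
  match theta with
  | OutputLayer _ _ W _ => [:: frobenius W ^+ 2]
  | HiddenLayer _ _ _ _ W _ theta' => frobenius W ^+ 2 :: layer_sqnorms theta'
  end.

Section Networks.
Set Implicit Arguments.
Unset Strict Implicit.
Context {R : realType}.

Lemma size_layer_sqnorms L p q (theta : relu_net R L p q) :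
  size (layer_sqnorms theta) = L.
Proof. by elim: theta => //= {}L {}p k {}q W b theta ->. Qed.

Lemma layer_sqnorms_ge0 L p q (theta : relu_net R L p q) s :
  s \in layer_sqnorms theta -> 0 <= s.
Proof.
elim: theta => /= [{}p {}q W b|{}L {}p k {}q W b theta IH].
  by rewrite inE => /eqP ->; exact: sqr_ge0.
by rewrite inE => /predU1P[->|/IH//]; exact: sqr_ge0.
Qed.

Lemma weight_sqnormE L p q (theta : relu_net R L p q) :
  weight_sqnorm theta = \sum_(s <- layer_sqnorms theta) s.
Proof.
elim: theta => /= [{}p {}q W b|{}L {}p k {}q W b theta ->].
  by rewrite big_seq1.
by rewrite big_cons.
Qed.

(** AM-GM: [net_cost] is the arithmetic mean of the [L] squared Frobenius norms. *)
Lemma prod_layer_sqnorms_le L p q (theta : relu_net R L p q) :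
  \prod_(s <- layer_sqnorms theta) s <= net_cost theta ^+ L.
Proof.
pose E (i : 'I_L) := (layer_sqnorms theta)`_i.
have E0 : {in 'I_L, forall i, 0 <= E i}.
  move=> i _; apply: (@layer_sqnorms_ge0 _ _ _ theta).
  by rewrite mem_nth// size_layer_sqnorms.
have [+ _] := leif_AGM E0; rewrite card_ord.
rewrite /net_cost weight_sqnormE mulrC.
have nthE op idx : \big[op/idx]_(s <- layer_sqnorms theta) s =
    \big[op/idx]_(i < L) E i.
  by rewrite (big_nth 0) size_layer_sqnorms big_mkord.
by rewrite !nthE.
Qed.

Lemma dot_relu_le n (x y : 'cV[R]_n) :
  dot (relu x - relu y) (relu x - relu y) <= dot (x - y) (x - y).
Proof.
apply: ler_sum => i _; rewrite !mxE -!expr2 -ler_sqrt ?sqr_ge0// !sqrtr_sqr.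
by rewrite !maxEle; case: ifP => ?; case: ifP => ?; rewrite ler_norml;
   have := ler_norm (x i 0 - y i 0); have := ler_norm (y i 0 - x i 0);
   rewrite (distrC (y i 0)); lra.
Qed.

(* [c j] is a squared Lipschitz constant of the j-th output component; summing
   over the rows of the last layer is what makes the sum, and not only the
   maximum, of the [c j] bounded by the product. *)
Lemma realize_lipschitz L p q (theta : relu_net R L p q) :
  exists c : 'I_q -> R, [/\ forall j, 0 <= c j,
    \sum_j c j <= \prod_(s <- layer_sqnorms theta) s &
    forall x y j, (realize theta x j 0 - realize theta y j 0) ^+ 2 <=
      c j * dot (x - y) (x - y)].
Proof.
elim: theta => /= [{}p {}q W b|{}L {}p k {}q W b theta [c [c0 sum_c lip_c]]].
  exists (fun j => dot (row j W)^T (row j W)^T); split.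
  - by move=> j; exact: dot_ge0.
  - by rewrite big_seq1 sqr_frobenius_rows.
  - move=> x y j; rewrite (_ : _ - _ = (W *m (x - y)) j 0).
      by rewrite mulmx_entry dot_cauchy_schwarz.
    by rewrite mulmxBr !mxE; ring.
exists (fun j => c j * frobenius W ^+ 2); split.
- by move=> j; rewrite mulr_ge0 ?sqr_ge0.
- by rewrite -mulr_suml big_cons mulrC ler_wpM2l ?sqr_ge0.
- move=> x y j; apply: (le_trans (lip_c _ _ j)); rewrite -mulrA ler_wpM2l//.
  apply: (le_trans (dot_relu_le _ _)).
  rewrite (_ : _ - _ = W *m (x - y)) ?dot_mulmx_le//.
  by rewrite mulmxBr opprD addrACA subrr addr0.
Qed.

Lemma hidden_layer_inv L p q (theta : relu_net R L.+2 p q) :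
  exists k (W : 'M[R]_(k, p)) b theta',
    theta = @HiddenLayer R L.+1 p k q W b theta'.
Proof.
(* Letting the depth index vary, with a trivial goal below depth 2, allows case analysis on the
   indexed family. *)
pose P l p q : relu_net R l p q -> Prop :=
  match l with
  | l'.+2 => fun th => exists k (W : 'M[R]_(k, p)) b theta',
      th = @HiddenLayer R l'.+1 p k q W b theta'
  | _ => fun _ => True
  end.
suff H l r s (th : relu_net R l r s) : P l r s th by exact: (H _ _ _ theta).
case: l r s / th => [//|[//|l] r k s W b th].
by exists k, W, b, th.
Qed.

(* All variables stand for squares.  The cross products r = N * a1 * c2 and
   s = N * a2 * c1 satisfy r * s = (N * a1 * c1) * (N * a2 * c2) >= K^2, so that
   r + s >= 2 K, with near equality only if r and s are both close to K. *)
Lemma weights_bound (N a1 a2 c1 c2 K P : R) :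
  0 <= N -> 0 <= a1 -> 0 <= a2 -> 0 <= c1 -> 0 <= c2 -> 0 < K ->
  K <= N * a1 * c1 -> K <= N * a2 * c2 ->
  5 * K <= 4 * (N * Num.max a1 a2 * Num.max c1 c2) ->
  N * (a1 + a2) * (c1 + c2) <= P -> 81 * K <= 20 * P.
Proof.
move=> N0 a10 a20 c10 c20 K0 h1 h2 h3 hP.
suff : 81 * K <= 20 * (N * (a1 + a2) * (c1 + c2)) by lra.
have rs : N * a1 * c2 * (N * a2 * c1) = N * a1 * c1 * (N * a2 * c2) by ring.
have s0 : 0 <= N * a2 * c1 by rewrite !mulr_ge0.
have r0 : 0 <= N * a1 * c2 by rewrite !mulr_ge0.
rewrite (_ : N * (a1 + a2) * (c1 + c2) =
  N * a1 * c1 + N * a2 * c2 + N * a1 * c2 + N * a2 * c1); last by ring.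
(* The product of the two maxima is one of four products, so one of these reaches 5/4 K. *)
have h3' : 5 * K <= 4 * (N * a1 * c1) \/ 5 * K <= 4 * (N * a2 * c2) \/
    5 * K <= 4 * (N * a1 * c2) \/ 5 * K <= 4 * (N * a2 * c1).
  by move: h3; case: (leP a1 a2) => _; case: (leP c1 c2) => _; tauto.
move: (N * a1 * c1) (N * a2 * c2) (N * a1 * c2) (N * a2 * c1)
  h1 h2 rs r0 s0 h3' => x y r s xK yK rs r0 s0.
have rsK : K * K <= r * s by rewrite rs ler_pM// ltW.
have rs_ge (k : R) : 0 <= k -> k ^+ 2 * (K * K) <= 4 * (r * s) ->
    k * K <= r + s.
  move=> k0 h; rewrite -ler_sqr ?nnegrE ?addr_ge0 ?(mulr_ge0 k0) ?(ltW K0)//.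
  by have := sqr_ge0 (r - s); lra.
(* By factoring [u ^+ 2 + K ^+ 2 - (5/4 + 4/5) * K * u], where 5/4 + 4/5 = 205/100. The worst total
   over the four cases is then 2 + 205/100 = 81/20. *)
have rs_ge' (u v : R) : 5 * K <= 4 * u -> K * K <= u * v ->
    205 / 100 * K <= u + v.
  move=> uK uv; have u0 : 0 < u by lra.
  rewrite -(ler_pM2l u0).
  have : 0 <= (u - 5 / 4 * K) * (u - 4 / 5 * K) by rewrite mulr_ge0//; lra.
  by lra.
(* An excess in [x] or [y] passes to [r * s]; the constant 22/10 is admissible since its square is
   below 4 * 5/4. *)
case=> [h|[h|[h|h]]].
- have : 5 / 4 * K * K <= r * s by rewrite rs; apply: ler_pM; lra.
  by move=> rs'; have : 22 / 10 * K <= r + s by [apply: rs_ge; lra]; lra.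
- have : 5 / 4 * K * K <= r * s.
    by rewrite rs [x * y]mulrC; apply: ler_pM; lra.
  by move=> rs'; have : 22 / 10 * K <= r + s by [apply: rs_ge; lra]; lra.
- by have := rs_ge' r s h rsK; lra.
- by have := rs_ge' s r h; rewrite [s * r]mulrC => /(_ rsK); lra.
Qed.

(* The increments of the midpoint network are t / 2, whence a constant just
   below 1 / 2. *)
Lemma T_shape_bound L p q (theta : relu_net R L.+3 p q) (c : 'cV[R]_p) (t : R)
    (i0 i1 : 'I_p) (j0 j1 : 'I_q) :
  let g x j := realize theta x j 0 in
  let x1 := c + t *: delta_mx i0 0 in
  let x2 := c - t *: delta_mx i0 0 in
  let x3 := c + t *: delta_mx i1 0 in
  let k := 499 / 1000 * t in
  0 < t -> i0 != i1 -> j0 != j1 ->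
  k < g x1 j0 - g c j0 -> k < g c j0 - g x2 j0 -> k < g x3 j1 - g c j1 ->
  k < g x1 j0 - g x3 j0 -> k < g x3 j0 - g x2 j0 ->
  201 / 200 <= \prod_(s <- layer_sqnorms theta) s.
Proof.
have r0 : 0 < 499 / 1000 :> R by lra.
have [n1 [W1 [b1 [theta1 ->]]]] := hidden_layer_inv theta.
have [n2 [W2 [b2 [theta2 ->]]]] := hidden_layer_inv theta1.
have [l [l0 sum_l lip_l]] := realize_lipschitz theta2.
move=> g x1 x2 x3 k t0 i01 j01 h1 h2 h3 h4 h5.
have k0 : 0 < k by exact: mulr_gt0 r0 t0.
pose z x := relu (W1 *m x + b1).
have gz x y j : (g x j - g y j) ^+ 2 <=
    l j * dot (W2 *m (z x - z y)) (W2 *m (z x - z y)).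
  apply: (le_trans (lip_l _ _ j)); rewrite ler_wpM2l//.
  apply: (le_trans (dot_relu_le _ _)).
  by rewrite mulmxBr opprD addrACA subrr addr0.
have kgz x y j : k < g x j - g y j ->
    k ^+ 2 <= l j * dot (W2 *m (z x - z y)) (W2 *m (z x - z y)).
  move=> kg; apply: le_trans (gz x y j).
  by rewrite ler_sqr ?nnegrE ltW// (lt_trans k0).
(* [a i] will bound the squared displacement in the first hidden layer when the input moves from [c]
   by [t] or [- t] along axis [i]. *)
pose a i := t ^+ 2 * dot (col i W1) (col i W1).
have a0 i : 0 <= a i by rewrite mulr_ge0 ?sqr_ge0 ?dot_ge0.
have za x i s : s ^+ 2 = t ^+ 2 -> x - c = s *: delta_mx i 0 ->
    dot (z x - z c) (z x - z c) <= a i.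
  move=> st xc; apply: (le_trans (dot_relu_le _ _)).
  rewrite (_ : _ - _ = W1 *m (x - c)); last first.
    by rewrite mulmxBr opprD addrACA subrr addr0.
  by rewrite xc -scalemxAr -colE dotZl dotZr mulrA -expr2 st.
have xc1 : x1 - c = t *: delta_mx i0 0 by rewrite addrAC subrr add0r.
have xc2 : x2 - c = (- t) *: delta_mx i0 0.
  by rewrite addrAC subrr add0r scaleNr.
have xc3 : x3 - c = t *: delta_mx i1 0 by rewrite addrAC subrr add0r.
have u1a := za _ _ _ erefl xc1; have u3a := za _ _ _ erefl xc3.
have u2a := za _ _ _ (sqrrN t) xc2.
set u1 := z x1 - z c in u1a; set u2 := z x2 - z c in u2a.
set u3 := z x3 - z c in u3a.
have dotN (u v : 'cV[R]_n1) :
    dot (W2 *m (u - v)) (W2 *m (u - v)) = dot (W2 *m (v - u)) (W2 *m (v - u)).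
  by rewrite -opprB mulmxN -scaleN1r dotZl dotZr mulrA mulrNN !mul1r.
have subc (u v w : 'cV[R]_n1) : (u - w) - (v - w) = u - v.
  by rewrite opprB addrA subrK.
have [k1 k2 k3] : [/\ k ^+ 2 <= l j0 * dot (W2 *m u1) (W2 *m u1),
    k ^+ 2 <= l j0 * dot (W2 *m u2) (W2 *m u2) &
    k ^+ 2 <= l j1 * dot (W2 *m u3) (W2 *m u3)].
  by split; [exact: kgz|rewrite -[u2]subr0 dotN sub0r opprB; exact: kgz|
             exact: kgz].
(* By [h5] the output at [x3] exceeds the one at [x2], so the bound [h4] carries over. *)
have k12 : k ^+ 2 <= l j0 * dot (W2 *m (u1 - u2)) (W2 *m (u1 - u2)).
  rewrite subc; apply: kgz; apply: (lt_trans h4).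
  by rewrite ltrD2l ltrN2 -subr_gt0 (lt_trans k0).
have k13 : k ^+ 2 <= l j0 * dot (W2 *m (u1 - u3)) (W2 *m (u1 - u3)).
  by rewrite subc; exact: kgz.
have k23 : k ^+ 2 <= l j0 * dot (W2 *m (u2 - u3)) (W2 *m (u2 - u3)).
  by rewrite subc dotN; exact: kgz.
pose C := Num.max (l j0) (l j1); pose A := Num.max (a i0) (a i1).
(* Dividing by the larger Lipschitz constant gives all six lower bounds the common form
   [k ^+ 2 / C]; [C] cannot vanish because [k ^+ 2] is positive. *)
have lC j (v : 'cV[R]_n2) : l j <= C -> k ^+ 2 <= l j * dot v v ->
    k ^+ 2 / C <= dot v v.
  move=> ljC kl; have kC : k ^+ 2 <= C * dot v v.
    by apply: (le_trans kl); rewrite ler_wpM2r ?dot_ge0.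
  rewrite ler_pdivrMr ?[dot v v * _]mulrC//.
  rewrite lt_neqAle (le_trans (l0 j))// andbT; apply/eqP => C0.
  by move: kC; rewrite -C0 mul0r leNgt exprn_gt0.
have lj0 : l j0 <= C by rewrite le_max lexx.
have lj1 : l j1 <= C by rewrite le_max lexx orbT.
have ai0 : a i0 <= A by rewrite le_max lexx.
have ai1 : a i1 <= A by rewrite le_max lexx orbT.
have := three_vectors_bound (le_trans u1a ai0) (le_trans u2a ai0)
  (le_trans u3a ai1) (lC _ _ lj0 k1) (lC _ _ lj0 k2) (lC _ _ lj1 k3)
  (lC _ _ lj0 k12) (lC _ _ lj0 k13) (lC _ _ lj0 k23).
have C0 : 0 < C.
  rewrite (lt_le_trans _ lj0)// lt_neqAle l0 andbT; apply/eqP => l00.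
  by move: k1; rewrite -l00 mul0r leNgt exprn_gt0.
rewrite [5 * _]mulrA (ler_pdivrMr _ _ C0) -(mulrA 4) => ACk.
set N := frobenius W2 ^+ 2 in ACk *.
have N0 : 0 <= N by exact: sqr_ge0.
have sum2 n (f : 'I_n -> R) i j : (forall i, 0 <= f i) -> i != j ->
    f i + f j <= \sum_i f i.
  move=> f0 ij; rewrite (bigD1 i)//= (bigD1 j) ?[j == i]eq_sym//= addrA lerDl.
  by apply: sumr_ge0.
have kNa u i j : dot u u <= a i -> k ^+ 2 <= l j * dot (W2 *m u) (W2 *m u) ->
    k ^+ 2 <= N * a i * l j.
  move=> ua kl; apply: (le_trans kl); rewrite mulrC ler_wpM2r//.
  by apply: (le_trans (dot_mulmx_le _ _)); rewrite ler_wpM2l.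
rewrite !big_cons -/N; set M := \prod_(_ <- layer_sqnorms theta2) _ in sum_l *.
(* As [i0 != i1] and [j0 != j1], both sums are partial sums: of the squared column norms of [W1] and
   of the constants [l]. *)
have NP : N * (a i0 + a i1) * (l j0 + l j1) <=
    t ^+ 2 * (frobenius W1 ^+ 2 * (N * M)).
  rewrite (_ : t ^+ 2 * _ = N * (t ^+ 2 * frobenius W1 ^+ 2) * M); last by ring.
  apply: ler_pM; rewrite ?(mulr_ge0 N0) ?addr_ge0//.
    rewrite ler_wpM2l// /a -mulrDr ler_wpM2l ?sqr_ge0// sqr_frobenius_cols.
    apply: (sum2 _ (fun i => dot (col i W1) (col i W1))) => // i.
    exact: dot_ge0.
  by apply: le_trans sum_l; exact: sum2.
(* The constants close up: 81/20 * (499/1000)^2 is about 1.008, above 201/200. *)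
have := weights_bound N0 (a0 i0) (a0 i1) (l0 j0) (l0 j1) (exprn_gt0 2 k0)
  (kNa _ _ _ u1a k1) (kNa _ _ _ u3a k3) ACk NP.
rewrite /k exprMn; set P := frobenius _ ^+ 2 * _ => tP.
have t2 : 0 < t ^+ 2 by rewrite exprn_gt0.
rewrite -(ler_pM2l t2); set T := t ^+ 2 in tP t2 *.
by move: (T * P) tP => TP tP; clear -t2 tP; lra.
Qed.

End Networks.

(** * Weak* continuity of increments and lower bounds for the relaxed cost *)

Section WeakStarEvaluation.
Set Implicit Arguments.
Unset Strict Implicit.
Context {R : realType} {d D : nat} {X : set 'cV[R]_d} {e : X}.

(** The supremum topology is finer than each of its members. *)
Lemma sup_topology_continuous (T : choiceType) (I : Type)
    (Tc : I -> Topological T) (U : topologicalType) (f : T -> U) (i : I) :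
  continuous (f : Topological.Pack (Tc i) -> U) ->
  continuous (f : sup_topology Tc -> U).
Proof.
move=> cf t; apply: cvg_trans (cf t); apply: cvg_app.
by have [+ _] := cvg_sup Tc t (nbhs_filter (t : sup_topology Tc)); exact.
Qed.

Lemma ae_norm0 : ae_norm (0 : X -> R) <= 0.
Proof.
rewrite /ae_norm; apply: ge_inf.
  exists 0 => _ [s _ <-]; apply: sumr_ge0 => t _.
  by rewrite mulr_ge0 ?enorm_ge0.
exists [::]; last by rewrite /mol_cost big_nil.
by apply/funext => x; rewrite /molecule big_nil.
Qed.

(** Makes the constant sequence delta_x - delta_y a point of AE(X). *)
Lemma ae_dirac_cauchy (x y : X) (eps : R) : 0 < eps ->
  exists N : nat, forall i j : nat, (N <= i)%N -> (N <= j)%N ->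
    ae_norm (molecule [:: ((1 : R), (x, y))] - molecule [:: ((1 : R), (x, y))])
      < eps.
Proof. by exists 0 => *; rewrite subrr (le_lt_trans ae_norm0). Qed.

Lemma wstar_functional_continuous (i : 'I_D * AE X + 'I_D) :
  continuous (wstar_functional e i : wstar D e -> R).
Proof.
apply: (@sup_topology_continuous _ _ _ _ _ i).
exact: (@initial_continuous _ _ (wstar_functional e i)).
Qed.

(** The increment is the pairing with delta_x - delta_y; the values at [e] cancel. *)
Lemma wstar_evalB_continuous (x y : X) (j : 'I_D) :
  continuous (fun g : wstar D e =>
    (g : Lip D X) x j 0 - (g : Lip D X) y j 0 : R).
Proof.
have -> : (fun g : wstar D e => (g : Lip D X) x j 0 - (g : Lip D X) y j 0) =
    wstar_functional e (inl (j, MkAE (ae_dirac_cauchy x y))).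
  apply/funext => g /=; apply/esym/cvg_lim => //=.
  rewrite /mol_pair big_seq1 /= mul1r opprB addrA subrK; exact: cvg_cst.
exact: wstar_functional_continuous.
Qed.

Lemma open_wstar_evalB (x y : X) (j : 'I_D) (k : R) :
  open [set g : wstar D e | k < (g : Lip D X) x j 0 - (g : Lip D X) y j 0].
Proof.
have /continuousP evalB := @wstar_evalB_continuous x y j.
exact: (evalB _ (@open_gt _ k)).
Qed.

Lemma rep_cost_le L (f : Lip D X) : (rep_cost e L f <= param_cost L f)%E.
Proof.
by have [_ + _] := lsc_reg_largest (param_cost L : wstar D e -> \bar R); apply.
Qed.

Lemma net_cost_ge0 L p q (theta : relu_net R L p q) : 0 <= net_cost theta.
Proof.
rewrite mulr_ge0 ?invr_ge0// weight_sqnormE big_seq.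
by apply: sumr_ge0 => s; exact: layer_sqnorms_ge0.
Qed.

(** The function equal to [a] on [V] and 0 elsewhere is l.s.c., as [V] is open and [a >= 0], and it
    lies below [param_cost]. *)
Lemma rep_cost_ge_on_open L (V : set (wstar D e)) (a : R) (f : Lip D X) :
  open V -> V f -> 0 <= a ->
  (forall g : Lip D X, V g -> forall theta : relu_net R L d D,
    (forall x : X, realize theta (val x) = g x) -> a <= net_cost theta) ->
  (a%:E <= rep_cost e L f)%E.
Proof.
move=> oV Vf a0 Va.
pose H (g : wstar D e) : \bar R := if `[< V g >] then a%:E else 0%E.
have [_ _ largest] := lsc_reg_largest (param_cost L : wstar D e -> \bar R).
suff : (H f <= rep_cost e L f)%E by rewrite /H asboolT.
apply: largest.
- move=> g b; rewrite /H; case: asboolP => [Vg ba|_ b0].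
    exists V; first exact: open_nbhs_nbhs.
    by move=> h Vh; rewrite asboolT.
  exists setT; first exact: filterT.
  by move=> h _; apply: (lt_le_trans b0); case: ifP; rewrite ?lee_fin.
- move=> g; rewrite /H /param_cost; case: asboolP => [Vg|_];
    apply: le_ereal_inf_tmp => _ [theta gtheta <-]; rewrite lee_fin.
    exact: (Va g).
  exact: net_cost_ge0.
Qed.

Lemma rep_cost_ge0 L (f : Lip D X) : (0 <= rep_cost e L f)%E.
Proof.
apply: (@rep_cost_ge_on_open _ setT) => //; first exact: openT.
by move=> g _ theta _; exact: net_cost_ge0.
Qed.

End WeakStarEvaluation.

(** * Single-neuron maps of cost at most one *)

Section Hinge.
Set Implicit Arguments.
Unset Strict Implicit.
Context {R : realType}.

Lemma sqr_frobenius_delta m n (i : 'I_m) (j : 'I_n) :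
  frobenius (delta_mx i j : 'M[R]_(m, n)) ^+ 2 = 1.
Proof.
rewrite sqr_frobenius_cols (bigD1 j)//= big1 ?addr0 => [|k kj].
  rewrite /dot (bigD1 i)//= big1 ?addr0 => [|k ki]; rewrite !mxE ?eqxx ?mulr1//.
  by rewrite (negPf ki) mul0r.
by rewrite /dot big1// => l _; rewrite !mxE (negPf kj) andbF mul0r.
Qed.

(** A chain of width-one layers of weight 1: ReLU is the identity on nonnegative numbers, so each
    layer adds depth at squared norm 1. *)
Lemma scalar_net L q (j : 'I_q) (b : 'cV[R]_q) :
  exists theta : relu_net R L.+1 1 q, weight_sqnorm theta = L.+1%:R /\
    forall z : 'cV_1, 0 <= z 0 0 -> realize theta z = z 0 0 *: delta_mx j 0 + b.
Proof.
elim: L => [|L [theta [costE realizeE]]].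
  exists (OutputLayer (delta_mx j 0) b); split; first exact: sqr_frobenius_delta.
  move=> z _ /=; congr (_ + _); apply/matrixP => i k; rewrite !mxE big_ord1 !mxE.
  by rewrite (ord1 k) mulrC.
exists (HiddenLayer (delta_mx 0 0) 0 theta); split=> /=.
  by rewrite sqr_frobenius_delta costE -[RHS]natr1 addrC.
move=> z z0; have -> : relu (delta_mx 0 0 *m z + 0) = z; last exact: realizeE.
apply/matrixP => i k; rewrite !mxE big_ord1 !mxE !ord1 !eqxx mul1r addr0.
exact/max_idPr.
Qed.

Context {d D : nat} {X : set 'cV[R]_d}.
Variables (e : X) (i : 'I_d) (j : 'I_D) (h : R).

(** The constant makes the map vanish at [e], so that [enorm (f e)] does not contribute to [F_norm];
    as a bias it is free of cost. *)
Definition hinge (x : X) : 'cV[R]_D :=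
  Num.max 0 (val x i 0 - h) *: delta_mx j 0
  - Num.max 0 (val e i 0 - h) *: delta_mx j 0.

Lemma hinge_lipschitz : hinge \in @lipschitz_map R d D X.
Proof.
rewrite inE; exists 1 => x y; rewrite mul1r.
rewrite /hinge opprB addrA subrK -scalerBl enormZ.
have -> : enorm (delta_mx j 0 : 'cV[R]_D) = 1.
  apply: (@pexpIrn _ 2); rewrite ?nnegrE ?enorm_ge0// expr1n.
  rewrite sqr_enorm -(sqr_frobenius_delta j (0 : 'I_1)) sqr_frobenius_cols.
  by rewrite big_ord1 col_id.
rewrite mulr1; apply: (@le_trans _ _ `|(val x - val y) i 0|).
  rewrite !mxE !maxEle; case: ifP => ?; case: ifP => ?; rewrite ler_norml;
  have := ler_norm (val x i 0 - val y i 0);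
  have := ler_norm (val y i 0 - val x i 0);
  rewrite (distrC (val y i 0)); lra.
rewrite -ler_sqr ?nnegrE ?enorm_ge0// sqr_enorm real_normK ?num_real//.
rewrite /dot (bigD1 i)//= -expr2 lerDl; apply: sumr_ge0 => k _.
by rewrite -expr2 sqr_ge0.
Qed.

Definition lip_hinge : Lip D X := MkLip hinge_lipschitz.

Lemma lip_hinge_base : lip_hinge e = 0.
Proof. by rewrite /= /hinge subrr. Qed.

(** All [L.+2] layers of the realizing network have Frobenius norm 1, and so has their mean
    square. *)
Lemma param_cost_hinge L : (param_cost L.+2 lip_hinge <= 1)%E.
Proof.
have [theta [costE realizeE]] :=
  scalar_net L j (- (Num.max 0 (val e i 0 - h) *: delta_mx j 0)).
apply: ge_ereal_inf.
exists (net_cost (HiddenLayer (delta_mx 0 i) (const_mx (- h)) theta))%:E.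
  exists (HiddenLayer (delta_mx 0 i) (const_mx (- h)) theta) => // x /=.
  have zE : relu (delta_mx (0 : 'I_1) i *m val x + const_mx (- h)) 0 0
      = Num.max 0 (val x i 0 - h).
    rewrite !mxE (bigD1 i)//= big1 ?addr0 => [|k ki]; rewrite !mxE ?eqxx ?mul1r//.
    by rewrite (negPf ki) mul0r.
  by rewrite realizeE zE// le_max lexx.
rewrite lee_fin /net_cost /= costE sqr_frobenius_delta nat1r.
by rewrite mulVf// pnatr_eq0.
Qed.

End Hinge.

(** * Midpoints, and the cost of the midpoint of two hinges *)

Section Balls.
Set Implicit Arguments.
Unset Strict Implicit.
Context {R : realType}.

Lemma poweR_le1 (x : \bar R) (r : R) : 0 < r -> (0 <= x)%E ->
  (poweR x r <= 1)%E = (x <= 1)%E.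
Proof.
have r1 : 1 `^ r = 1 by rewrite powR1.
move=> r0; case: x => [x| |]//=; last by rewrite gt_eqF.
rewrite !lee_fin => x0; apply/idP/idP => [|x1].
  rewrite !leNgt; apply: contra => x1.
  by rewrite -[ltLHS]r1; apply: gt0_ltr_powR => //; rewrite ?nnegrE.
by rewrite -[leRHS]r1; apply: ge0_ler_powR => //; rewrite ?nnegrE// ltW.
Qed.

(** [F] need not be a subspace: finiteness of [p] places the two halves in [F], where subadditivity
    applies. *)
Lemma seminorm_midpoint_le1 (V : lmodType R) (F : set V) (p : V -> \bar R)
    (f g : V) :
  seminorm_on F p -> (forall h, (p h < +oo)%E -> F h) ->
  F f -> F g -> (p f <= 1)%E -> (p g <= 1)%E ->
  (p (2^-1 *: f + 2^-1 *: g)%R <= 1)%E.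
Proof.
move=> [pZ pD] pF Ff Fg pf pg.
have half h : F h -> (p h <= 1)%E -> (p (2^-1 *: h)%R <= (2^-1)%:E)%E.
  move=> Fh ph; rewrite pZ// ger0_norm ?invr_ge0//.
  by rewrite -[leRHS]mule1 lee_pmul2l// ?lte_fin ?invr_gt0.
have Fhalf h : F h -> (p h <= 1)%E -> F (2^-1 *: h).
  by move=> Fh ph; apply: pF; rewrite (le_lt_trans (half h Fh ph))// ltry.
apply: (le_trans (pD _ _ (Fhalf _ Ff pf) (Fhalf _ Fg pg))).
apply: (le_trans (leeD (half _ Ff pf) (half _ Fg pg))).
by rewrite -EFinD lee_fin; lra.
Qed.

Lemma convex_set_midpoint (V : lmodType R) (A : set V) (f g : V) :
  convex_set A -> A f -> A g -> A (2^-1 *: f + 2^-1 *: g).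
Proof.
move=> cA Af Ag.
have h0 : 0 <= 2^-1 :> R by rewrite invr_ge0.
have h1 : 2^-1 <= 1 :> R by rewrite invf_le1// ler1n.
have := cA f g (Itv01 h0 h1) (mem_set Af) (mem_set Ag); rewrite inE.
have halfE : 1 - 2^-1 = 2^-1 :> R by lra.
by move=> Afg; rewrite -[X in A (_ + X *: g)]halfE.
Qed.

Context {d D : nat} {X : set 'cV[R]_d}.

Lemma interior_cross (X_int : X° !=set0) (i0 i1 : 'I_d) :
  exists (c : 'cV[R]_d) (t : R), [/\ 0 < t, X c,
    X (c + t *: delta_mx i0 0), X (c - t *: delta_mx i0 0) &
    X (c + t *: delta_mx i1 0)].
Proof.
have [c /nbhs_ballP[r /= r0 cX]] := X_int.
(* Balls are those of the maximum norm, and only one entry moves. *)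
have cXt s i : `|s| < r -> X (c + s *: delta_mx i 0).
  move=> sr; apply: cX; split=> // k l; rewrite /ball /= !mxE opprD addrA.
  rewrite subrr sub0r normrN normrM (le_lt_trans _ sr)// ler_piMr//.
  by case: (_ && _); rewrite ?normr1 ?normr0.
have t0 : 0 < r / 2 by rewrite divr_gt0.
have tr : `|r / 2| < r by rewrite gtr0_norm// ltr_pdivrMr// ltr_pMr// ltr1n.
exists c, (r / 2); split=> //.
- by rewrite -[c]addr0 -(scale0r (delta_mx i0 0)); apply: cXt; rewrite normr0.
- exact: cXt.
- by rewrite -scaleNr; apply: cXt; rewrite normrN.
- exact: cXt.
Qed.

Context {e : X}.

(** With thresholds at distance [t] below [c], both hinges are affine on the four points, so the
    increments are exactly [t / 2]. *)
Lemma midpoint_hinges_rep_cost_gt1 L (i0 i1 : 'I_d) (j0 j1 : 'I_D)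
    (c : 'cV[R]_d) (t : R) :
  i0 != i1 -> j0 != j1 -> 0 < t -> X c ->
  X (c + t *: delta_mx i0 0) -> X (c - t *: delta_mx i0 0) ->
  X (c + t *: delta_mx i1 0) ->
  (1 < rep_cost e L.+3
    (2^-1 *: lip_hinge e i0 j0 (c i0 0 - t) +
     2^-1 *: lip_hinge e i1 j1 (c i1 0 - t))%R)%E.
Proof.
move=> i01 j01 t0 Xc X1 X2 X3; set f := _ + _.
pose pt x (Xx : X x) : X := exist (fun x => x \in X) x (mem_set Xx).
pose p0 := pt _ Xc; pose p1 := pt _ X1; pose p2 := pt _ X2; pose p3 := pt _ X3.
pose k := 499 / 1000 * t.
pose G x y j :=
  [set g : wstar D e | k < (g : Lip D X) x j 0 - (g : Lip D X) y j 0].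
pose V := G p1 p0 j0 `&` G p0 p2 j0 `&` G p3 p0 j1 `&` G p1 p3 j0 `&`
  G p3 p2 j0.
have oV : open V by rewrite /V; do !apply: openI; exact: open_wstar_evalB.
have kt : k < 2^-1 * t by rewrite /k ltr_pM2r//; lra.
have fE x : f x = 2^-1 *: lip_hinge e i0 j0 (c i0 0 - t) x +
  2^-1 *: lip_hinge e i1 j1 (c i1 0 - t) x by [].
have f0 x y : f x j0 0 - f y j0 0 =
    2^-1 * (Num.max 0 (val x i0 0 - (c i0 0 - t)) -
            Num.max 0 (val y i0 0 - (c i0 0 - t))).
  rewrite !fE !mxE !eqxx (negPf j01) /= !mulr0 !mulr1; ring.
have f1 x y : f x j1 0 - f y j1 0 =
    2^-1 * (Num.max 0 (val x i1 0 - (c i1 0 - t)) -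
            Num.max 0 (val y i1 0 - (c i1 0 - t))).
  rewrite !fE !mxE !eqxx [j1 == j0]eq_sym (negPf j01) /= !mulr0 !mulr1; ring.
have maxt s : 0 <= s -> Num.max 0 s = s by move=> s0; apply/max_idPr.
have Vf : V f.
  have tt : 0 <= t + t by rewrite addr_ge0// ltW.
  have tge := ltW t0.
  have e0 : c i0 0 - (c i0 0 - t) = t by ring.
  have e1 : c i1 0 - (c i1 0 - t) = t by ring.
  have e2 : c i0 0 + t - (c i0 0 - t) = t + t by ring.
  have e3 : c i1 0 + t - (c i1 0 - t) = t + t by ring.
  have e4 : c i0 0 - t - (c i0 0 - t) = 0 by ring.
  do !split; rewrite /G /= ?f0 ?f1 /= !mxE !eqxx ?(negPf i01) ?mulr1 ?mulr0
    ?addr0 ?e0 ?e1 ?e2 ?e3 ?e4 !maxt// ?subr0 ?addrK//.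
(* [a] is the root of order [L.+3] of 201/200: a cost below [a] would keep the product of the
   squared layer norms below 201/200. *)
have [a a1 aL] : exists2 a : R, 1 < a & a ^+ L.+3 <= 201 / 200.
  have h0 : 0 < L.+3%:R^-1 :> R by rewrite invr_gt0.
  exists ((201 / 200) `^ L.+3%:R^-1).
    have r1 : 1 `^ L.+3%:R^-1 = 1 :> R by rewrite powR1.
    rewrite -[ltLHS]r1; apply: gt0_ltr_powR => //; rewrite ?nnegrE; lra.
  by rewrite -powR_mulrn ?powR_ge0// -powRrM mulVf ?pnatr_eq0// powRr1//; lra.
have a0 : 0 <= a by rewrite ltW// (lt_trans _ a1).
apply: (@lt_le_trans _ _ a%:E); first by rewrite lte_fin.
apply: (rep_cost_ge_on_open oV Vf a0) => g [[[[g1 g2] g3] g4] g5] theta gE.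
rewrite leNgt; apply/negP => ca.
have prod_ge : 201 / 200 <= \prod_(s <- layer_sqnorms theta) s.
  have r0 := gE p0; have r1 := gE p1; have r2 := gE p2; have r3 := gE p3.
  rewrite /p0 /p1 /p2 /p3 /pt /= in r0 r1 r2 r3.
  have := @T_shape_bound _ L d D theta c t i0 i1 j0 j1; cbv beta zeta.
  by rewrite r0 r1 r2 r3 => /(_ t0 i01 j01 g1 g2 g3 g4 g5).
have := le_trans prod_ge (prod_layer_sqnorms_le theta).
apply/negP; rewrite -ltNge; apply: lt_le_trans aL.
by rewrite ltr_pXn2r ?nnegrE ?net_cost_ge0.
Qed.

End Balls.

(** * Nonconvexity of the balls and failure of the seminorm axioms *)

Theorem proposition9p5 (R : realType) (L d D : nat) (X : set 'cV[R]_d) (e : X)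
    (L_gt2 : (2 < L)%N) (d_ge2 : (2 <= d)%N) (D_ge2 : (2 <= D)%N)
    (X_int : X° !=set0) :
  let F : set (Lip D X) := F_space e L in
  let B1 : set (Lip D X) := [set f | F f /\ (rep_cost e L f <= 1)%E] in
  let B2 : set (Lip D X) := [set f | F f /\ (rep_cost_pow e L f <= 1)%E] in
  let B : set (Lip D X) := [set f | F f /\ (F_norm e L f <= 1)%E] in
  [/\ B1 = B2 /\ ~ convex_set B1 /\ ~ convex_set B2,
      ~ convex_set B,
      ~ seminorm_on F (rep_cost_pow e L) &
      ~ norm_on F (F_norm e L)].
Proof.
move=> F B1 B2 B.
have L2_gt0 : 0 < L%:R / 2 :> R by rewrite divr_gt0// ltr0n (leq_trans _ L_gt2).
have pow_le1 (f : Lip D X) :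
    (rep_cost_pow e L f <= 1)%E = (rep_cost e L f <= 1)%E.
  exact: poweR_le1 L2_gt0 (rep_cost_ge0 _ _).
(* One pair of hinges refutes all the convexity and seminorm claims. *)
have [f [g [fR gR f0 g0 fgR]]] : exists f g : Lip D X,
    [/\ (rep_cost e L f <= 1)%E, (rep_cost e L g <= 1)%E, f e = 0, g e = 0 &
        (1 < rep_cost e L (2^-1 *: f + 2^-1 *: g)%R)%E].
  pose i0 := Ordinal (ltnW d_ge2); pose i1 := Ordinal d_ge2.
  pose j0 := Ordinal (ltnW D_ge2); pose j1 := Ordinal D_ge2.
  have [c [t [t0 Xc X1 X2 X3]]] := interior_cross X_int i0 i1.
  (* [L > 2] provides a weight matrix strictly between the first and the last. *)
  case: L L_gt2 {F B1 B2 B L2_gt0 pow_le1} => [|[|[|l]]]// _.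
  exists (lip_hinge e i0 j0 (c i0 0 - t)), (lip_hinge e i1 j1 (c i1 0 - t)).
  split; first by rewrite (le_trans (rep_cost_le _ _))// param_cost_hinge.
  - by rewrite (le_trans (rep_cost_le _ _))// param_cost_hinge.
  - exact: lip_hinge_base.
  - exact: lip_hinge_base.
  - exact: midpoint_hinges_rep_cost_gt1.
have FP h : (rep_cost e L h <= 1)%E -> F h.
  by move=> h1; rewrite /F /F_space /= (le_lt_trans h1)// ltry.
have Ff := FP _ fR; have Fg := FP _ gR.
have norm_le1 (h : Lip D X) : (F_norm e L h <= 1)%E ->
    (rep_cost_pow e L h <= 1)%E by rewrite /F_norm ge_max => /andP[].
have norm_base (h : Lip D X) : h e = 0 -> (rep_cost e L h <= 1)%E ->
    (F_norm e L h <= 1)%E.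
  move=> h0 h1; rewrite /F_norm ge_max pow_le1 h1 h0 /= lee_fin.
  by rewrite -(scale0r (0 : 'cV[R]_D)) enormZ normr0 mul0r.
have B12 : B1 = B2 by apply/seteqP; split=> h [Fh h1]; split=> //;
  rewrite -?pow_le1 ?pow_le1// in h1 *.
have powF (h : Lip D X) : (rep_cost_pow e L h < +oo)%E -> F h.
  by apply: lty_poweRy; rewrite gt_eqF.
have nconv1 : ~ convex_set B1.
  move=> cB; have [] : B1 (2^-1 *: f + 2^-1 *: g).
    exact: convex_set_midpoint.
  by move=> _; rewrite leNgt fgR.
split.
- by rewrite -B12.
- move=> cB; have [] : B (2^-1 *: f + 2^-1 *: g).
    by apply: convex_set_midpoint => //; split=> //; exact: norm_base.
  by move=> _ /norm_le1; rewrite pow_le1 leNgt fgR.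
- move=> /seminorm_midpoint_le1/(_ powF Ff Fg).
  by rewrite !pow_le1 => /(_ fR gR); rewrite leNgt fgR.
- move=> [/seminorm_midpoint_le1 mid _].
  have normF (h : Lip D X) : (F_norm e L h < +oo)%E -> F h.
    by rewrite /F_norm gt_max => /andP[/powF].
  have /norm_le1 := mid f g normF Ff Fg (norm_base _ f0 fR) (norm_base _ g0 gR).
  by rewrite pow_le1 leNgt fgR.
Qed.
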